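(* Let $q$ be a prime power. If $p\in\mathbb{P}^2(\overline{\mathbb{F}}_q)$ is $q$-generic, then the line $\ell=\langle p,f(p)\rangle$ is $q$-generic.
   Context: $f=\mathrm{Frob}_q$ acts on $\mathbb{P}^2(\overline{\mathbb{F}}_q)$ by raising coordinates to the $q$th power, and correspondingly on lines. A $q$-point (respectively $q$-line) is a point (respectively line) fixed by $f$. A point is $q$-generic if it does not lie on any $q$-line; dually, a line is $q$-generic if it does not contain any $q$-point. For distinct points $p_1,p_2$, $\langle p_1,p_2\rangle$ is the unique line containing both (a $q$-generic point $p$ satisfies $p\ne f(p)$, since every $q$-point lies on a $q$-line). *)

(* Defs.v *)
From HB Require Import structures.
From mathcomp Require Import all_boot all_algebra all_fingroup all_solvable all_field.

Set Implicit Arguments.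
Unset Strict Implicit.
Unset Printing Implicit Defensive.

Import GRing.Theory.
Local Open Scope ring_scope.

(* P^2(K) in terms of the subspaces of K^3: points are the subspaces of
   dimension 1, lines are those of dimension 2, and incidence is inclusion. *)
Section ProjectivePlane.

Variable K : fieldType.

Record proj_subspace (d : nat) := ProjSubspace {
  proj_val :> {vspace 'rV[K]_3};
  _ : \dim proj_val == d }.

HB.instance Definition _ d := [isSub for @proj_val d].
HB.instance Definition _ d := [Choice of proj_subspace d by <:].

Definition point := proj_subspace 1.
Definition line := proj_subspace 2.

Definition on_line (P : point) (L : line) : bool := (P <= L)%VS.

Lemma dim_join (P Q : point) : P != Q -> \dim (P + Q)%VS == 2.
Proof.
case: P Q => [U dU] [V dV]; rewrite -val_eqE /= => UV.
have dUVU : (\dim (U :&: V) <= 1)%N by apply: leq_trans (dimvS (capvSl U V)) _; rewrite (eqP dU).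
have := dimv_sum_cap U V; rewrite (eqP dU) (eqP dV).
move: dUVU; rewrite leq_eqVlt ltnS leqn0 => /orP[dUV|/eqP->]; last first.
  by rewrite addn0 => ->.
case/eqP: UV; have sU: (U :&: V)%VS = U.
  by apply/eqP; rewrite eqEdim capvSl (eqP dU) (eqP dUV).
by apply/eqP; rewrite eqEdim -{1}sU capvSr (eqP dU) (eqP dV).
Qed.

Definition join (P Q : point) (PQ : P != Q) : line := ProjSubspace (dim_join PQ).

Lemma join_unique (P Q : point) (PQ : P != Q) (L : line) :
  (on_line P L && on_line Q L) = (L == join PQ).
Proof.
rewrite /on_line -subv_add -val_eqE /= eq_sym eqEdim.
by case: L => L dL /=; rewrite (eqP dL) (eqP (dim_join PQ)) andbT.
Qed.

End ProjectivePlane.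

(* iota : F -> K presents K as an extension of F = F_q, so q is #|F|; it only
   serves to tie F to K. *)
Section Frobenius.

Variables (F : finFieldType) (K : closedFieldType) (iota : {rmorphism F -> K}).

Definition frob (x : K) : K := x ^+ #|F|.

Lemma frobD x y : frob (x + y) = frob x + frob y.
Proof.
have [p p_pr charFp] := finPcharP F.
apply: exprDn_pchar; apply: (@sub_in_pnat p).
  by move=> r _ /eqP->; rewrite (fmorph_pchar iota).
by rewrite -cardsT; apply: abelem_pgroup (fin_ring_pchar_abelem charFp).
Qed.

Lemma frobM x y : frob (x * y) = frob x * frob y.
Proof. exact: exprMn. Qed.

Lemma frob_eq0 x : (frob x == 0) = (x == 0).
Proof. by rewrite expf_eq0 (cardD1 0) inE. Qed.

Lemma frob_surj y : exists x, y = frob x.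
Proof.
have q_gt0: (0 < #|F|)%N by rewrite (cardD1 0) inE.
have [x Dx] := solve_monicpoly (nth 0 [:: y]) q_gt0.
exists x; rewrite /frob Dx; case: #|F| q_gt0 => // n _.
by rewrite big_ord_recl big1 ?addr0 ?mulr1 // => i _; rewrite nth_default ?mul0r.
Qed.

Definition frob_vec (u : 'rV[K]_3) : 'rV[K]_3 := map_mx frob u.

Lemma frob_vecD u v : frob_vec (u + v) = frob_vec u + frob_vec v.
Proof. by apply/rowP=> i; rewrite !mxE frobD. Qed.

Lemma frob_vecZ a u : frob_vec (a *: u) = frob a *: frob_vec u.
Proof. by apply/rowP=> i; rewrite !mxE frobM. Qed.

Lemma frob_vec_eq0 u : (frob_vec u == 0) = (u == 0).
Proof.
apply/eqP/eqP=> /rowP u0; apply/rowP=> i; move: (u0 i); rewrite !mxE => ui0.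
  by apply/eqP; rewrite -frob_eq0 ui0.
by apply/eqP; rewrite frob_eq0 ui0.
Qed.

Lemma frob_vec_sum n (w : 'I_n -> 'rV[K]_3) :
  frob_vec (\sum_i w i) = \sum_i frob_vec (w i).
Proof.
apply: (big_morph frob_vec frob_vecD).
by apply/eqP; rewrite frob_vec_eq0.
Qed.

(* The image of U under frob_vec, see frob_vspaceP. *)
Definition frob_vspace (U : {vspace 'rV[K]_3}) : {vspace 'rV[K]_3} :=
  <<map_tuple frob_vec (vbasis U)>>%VS.

Lemma frob_roots n (c : 'I_n -> K) : exists d : 'I_n -> K, forall i, c i = frob (d i).
Proof.
exact: (fin_all_exists (fun i => frob_surj (c i))).
Qed.

Lemma frob_comb (U : {vspace 'rV[K]_3}) (d : 'I_(\dim U) -> K) :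
  \sum_i frob (d i) *: (map_tuple frob_vec (vbasis U))`_i
  = frob_vec (\sum_i d i *: (vbasis U)`_i).
Proof.
rewrite frob_vec_sum; apply: eq_bigr => i _; rewrite frob_vecZ.
by rewrite (nth_map 0) ?size_tuple.
Qed.

Lemma frob_vspaceP (U : {vspace 'rV[K]_3}) v :
  reflect (exists2 u, u \in U & v = frob_vec u) (v \in frob_vspace U).
Proof.
apply: (iffP idP) => [/coord_span Dv | [u Uu ->]].
  have [d Dd] := frob_roots (fun i => coord (map_tuple frob_vec (vbasis U)) i v).
  exists (\sum_i d i *: (vbasis U)`_i).
    by apply: rpred_sum => i _; rewrite rpredZ ?vbasis_mem ?mem_nth ?size_tuple.
  by rewrite -frob_comb Dv; apply: eq_bigr => i _; rewrite Dd.
rewrite (coord_vbasis Uu) -frob_comb; apply: rpred_sum => i _.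
by rewrite rpredZ // memv_span // mem_nth ?size_tuple.
Qed.

Lemma dim_frob_vspace (U : {vspace 'rV[K]_3}) : \dim (frob_vspace U) = \dim U.
Proof.
suff /eqP->: free (map_tuple frob_vec (vbasis U)) by rewrite size_tuple.
apply/freeP=> c c0 i; have [d Dd] := frob_roots c.
have: \sum_i d i *: (vbasis U)`_i = 0.
  apply/eqP; rewrite -frob_vec_eq0 -frob_comb -[X in _ == X]c0; apply/eqP.
  by apply: eq_bigr => j _; rewrite Dd.
have /freeP free_bU := basis_free (vbasisP U).
move/free_bU/(_ i) => di0.
by apply/eqP; rewrite Dd frob_eq0 di0.
Qed.

Lemma dim_frob_proj d (U : proj_subspace K d) : \dim (frob_vspace U) == d.
Proof. by case: U => U dU; rewrite dim_frob_vspace. Qed.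

Definition frob_proj d (U : proj_subspace K d) : proj_subspace K d :=
  ProjSubspace (dim_frob_proj U).

Definition q_point (P : point K) : Prop := frob_proj P = P.
Definition q_line (L : line K) : Prop := frob_proj L = L.

Definition q_generic_point (P : point K) : Prop :=
  forall L : line K, q_line L -> ~ on_line P L.
Definition q_generic_line (L : line K) : Prop :=
  forall P : point K, q_point P -> ~ on_line P L.

Lemma q_point_on_q_line (P : point K) :
  q_point P -> exists2 L : line K, q_line L & on_line P L.
Proof.
move=> fP; have [i PNi]: exists i, delta_mx 0 i \notin (P : {vspace _}).
  apply/existsP; rewrite -negb_forall; apply/negP=> /forallP Pall.
  have: ({: 'rV[K]_3} <= P)%VS.
    apply/subvP=> u _; rewrite [u]row_sum_delta.
    by apply: rpred_sum => j _; rewrite rpredZ.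
  by move/dimvS; rewrite dimvf /dim /=; case: (P) => U /= /eqP->.
set e : 'rV[K]_3 := delta_mx 0 i in PNi.
have e0: e != 0 by apply: contraNneq PNi => ->; rewrite mem0v.
have dE: \dim <[e]> == 1 by rewrite dim_vline e0.
pose E : point K := ProjSubspace dE.
have PE: P != E by apply: contraNneq PNi => ->; rewrite memv_line.
have fe: frob_vec e = e.
  apply/rowP=> j; rewrite !mxE /frob; case: (_ && _); first by rewrite expr1n.
  by rewrite expr0n (cardD1 0) inE.
exists (join PE); last by rewrite /on_line addvSl.
apply: val_inj; apply/eqP; rewrite /= eqEdim dim_frob_vspace leqnn andbT.
apply/subvP=> _ /frob_vspaceP[_ /memv_addP[u Pu [_ /vlineP[a ->] ->]] ->].
rewrite frob_vecD frob_vecZ fe memv_add ?rpredZ ?memv_line //.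
by rewrite -fP; apply/frob_vspaceP; exists u.
Qed.

Lemma q_generic_neq (P : point K) : q_generic_point P -> P != frob_proj P.
Proof.
move=> genP; apply/eqP=> /esym/q_point_on_q_line[L qL].
exact: genP qL.
Qed.

End Frobenius.

(* Main.v *)
Require Import Defs.
From mathcomp Require Import all_boot all_algebra all_field.

Import GRing.Theory.
Local Open Scope ring_scope.

(* A q-point r on the line l = <p, f(p)> differs from f(p), since f is injective
   and p is not a q-point. As l and f(l) both contain f(p) and r = f(r), they
   coincide, so l is a q-line through p, contradicting that p is q-generic. *)

Section FrobeniusInjectivity.

Variables (F : finFieldType) (K : closedFieldType) (iota : {rmorphism F -> K}).

(** An additive map with trivial kernel is injective; additivity relies on [iota], which forces K to
    have the characteristic of F. *)
Lemma frob_vec_inj : injective (@frob_vec F K).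
Proof.
move=> u v fuv; apply/eqP; rewrite -subr_eq0 -(frob_vec_eq0 F).
apply/eqP/(addIr (frob_vec F v)).
by rewrite -(frob_vecD iota) subrK add0r.
Qed.

(** Images of vectors have unique preimages, so an inclusion can be pulled back. Both injectivity on
    subspaces and invariance of incidence follow. *)
Lemma frob_vspaceS (U V : {vspace 'rV[K]_3}) :
  (frob_vspace F U <= frob_vspace F V)%VS = (U <= V)%VS.
Proof.
apply/subvP/subvP => [sUV u Uu | sUV _ /(frob_vspaceP iota)[u Uu ->]].
  have /sUV/(frob_vspaceP iota)[v Vv /frob_vec_inj-> //] :
    frob_vec F u \in frob_vspace F U by apply/(frob_vspaceP iota); exists u.
by apply/(frob_vspaceP iota); exists u; first exact: sUV.
Qed.

Lemma frob_proj_inj d : injective (@frob_proj F K iota d).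
Proof.
move=> U V /(congr1 val)/= fUV; apply/val_inj/eqP.
by rewrite /= eqEsubv -(frob_vspaceS U) -(frob_vspaceS V) fUV subvv.
Qed.

Lemma frob_on_line (P : point K) (L : line K) :
  on_line (frob_proj iota P) (frob_proj iota L) = on_line P L.
Proof. exact: frob_vspaceS. Qed.

End FrobeniusInjectivity.

Theorem lemma4p9 (F : finFieldType) (K : closedFieldType)
    (iota : {rmorphism F -> K}) (K_algebraic : integralRange iota)
    (p : point K) (p_generic : q_generic_point iota p) :
  q_generic_line iota (join (q_generic_neq p_generic)).
Proof.
move=> r qr rL; set L := join _ in rL.
have /andP[pL fpL] : on_line p L && on_line (frob_proj iota p) L.
  by rewrite (join_unique (q_generic_neq p_generic)).
have fp_neq_r : frob_proj iota p != r.
  apply: contraNneq (q_generic_neq p_generic) => fp_r.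
  (* From f(p) = r = f(r), injectivity gives p = r = f(p). *)
  by rewrite fp_r; apply/eqP/(@frob_proj_inj _ _ iota); rewrite fp_r qr.
apply: (p_generic L) (pL); rewrite /q_line.
have /eqP-> : frob_proj iota L == join fp_neq_r.
  (* Writing [r] as f(r) makes both incidences images under f of [p] and [r] lying on [L]. *)
  by rewrite -join_unique -qr !frob_on_line pL.
by apply/esym/eqP; rewrite -join_unique fpL.
Qed.
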